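(* Let $(\Omega,\Sigma,\mathbb{P})$ be a probability space and let $X$ be a Banach function space in $L_0(\Sigma)$ containing the constant functions. Let $f\in X$ with $f\ge0$, let $M=O_f=\operatorname{span}\{\mathbb 1,(f-k)^+:k\in\mathbb{R}\}$, and let $\pi$ be a positive linear functional on $M$. If $(M,\pi)$ admits no free lunches, then for every $g\in L_0(\sigma(f))\cap X$ the price of $g$ is determined by arbitrage from $(M,\pi)$.
   Context: $L_0(\Sigma)$ is the vector lattice of real-valued measurable functions modulo a.e. equality with the a.e. order. A Banach function space is an ideal $X$ of $L_0(\Sigma)$ (i.e. $|x|\le|y|$, $y\in X$ imply $x\in X$) endowed with a complete lattice norm. $X_+=\{x\in X:x\ge0\}$. A linear functional on $X$ is order continuous if $\phi(x_\alpha)\to0$ whenever $x_\alpha\to0$ in order (i.e. there is a net $z_\beta\downarrow0$ in $X$ such that for every $\beta$ eventually $|x_\alpha|\le z_\beta$); $X_n^\sim$ is the space of order continuous linear functionals, and $\sigma(X,X_n^\sim)$ is the weak topology induced by $X_n^\sim$. A functional is strictly positive if $\phi(x)>0$ for all $x\ge0$, $x\ne0$. $\sigma(f)$ is the smallest sub-$\sigma$-algebra making $f$ measurable and containing all null sets; $L_0(\sigma(f))$ the $\sigma(f)$-measurable elements of $L_0(\Sigma)$. Let $M_0=\{x\in M:\pi(x)=0\}$. $(M,\pi)$ admits no free lunches if $C\cap X_+=\{0\}$, where $C$ is the $\sigma(X,X_n^\sim)$-closure of $M_0-X_+$. A price $p\in\mathbb{R}$ of $g\in X$ is consistent with $(M,\pi)$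 if there exists a strictly positive $x^*\in X_n^\sim$ with $x^*|_M=\pi$ and $x^*(g)=p$. The price of $g$ is determined by arbitrage from $(M,\pi)$ if there is a single (i.e. exactly one) price $p$ for $g$ that is consistent with $(M,\pi)$. *)

(* Defs.v *)
From HB Require Import structures.
From mathcomp Require Import all_boot all_order all_algebra.
From mathcomp Require Import all_classical all_reals all_analysis.
Set Implicit Arguments. Unset Strict Implicit. Unset Printing Implicit Defensive.
Import Order.TTheory GRing.Theory Num.Theory.
Local Open Scope classical_set_scope.
Local Open Scope ring_scope.

(* Elements of L_0(Sigma) are represented by Sigma-measurable functions
   T -> R; equality/order in L_0 is a.e. equality/order w.r.t. P.
   All sets and functionals below are required to be compatible with
   a.e. equality. *)

Section Defs.
Context {d : measure_display} {T : measurableType d} {R : realType}.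
Variable P : probability T R.

Definition aeeq (x y : T -> R) : Prop := {ae P, forall w, x w = y w}.
Definition aele (x y : T -> R) : Prop := {ae P, forall w, x w <= y w}.

Definition is_ideal (X : set (T -> R)) : Prop :=
  [/\ (forall x, X x -> measurable_fun setT x),
      X (fun _ => 0),
      (forall x y : T -> R, X x -> X y -> X (x \+ y)),
      (forall (a : R) x, X x -> X (fun w => a * x w)) &
      (forall x y : T -> R, measurable_fun setT x -> X y ->
          aele (fun w => `|x w|) (fun w => `|y w|) -> X x)].

Definition banach_function_space (X : set (T -> R)) (N : (T -> R) -> R) : Prop :=
  is_ideal X /\
  [/\ (forall x y, X x -> X y -> N (x \+ y) <= N x + N y),
      (forall (a : R) x, X x -> N (fun w => a * x w) = `|a| * N x),
      (forall x, X x -> (N x = 0 <-> aeeq x (fun _ => 0))),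
      (forall x y, X x -> X y ->
          aele (fun w => `|x w|) (fun w => `|y w|) -> N x <= N y) &
      (forall u : nat -> (T -> R), (forall n, X (u n)) ->
         (forall e : R, 0 < e -> exists n0, forall m n, (n0 <= m)%N -> (n0 <= n)%N ->
              N (u m \- u n) < e) ->
         exists x, X x /\
           (forall e : R, 0 < e -> exists n0, forall n, (n0 <= n)%N ->
              N (u n \- x) < e))].

Definition linear_on (S : set (T -> R)) (phi : (T -> R) -> R) : Prop :=
  (forall (a : R) x y, S x -> S y -> phi (fun w => a * x w + y w) = a * phi x + phi y)
  /\ (forall x y, S x -> S y -> aeeq x y -> phi x = phi y).

Definition directed {D : Type} (le : D -> D -> Prop) : Prop :=
  [/\ (exists _ : D, True),
      (forall a, le a a),
      (forall a b c, le a b -> le b c -> le a c) &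
      (forall a b, exists c, le a c /\ le b c)].

Definition net_decr_to0 (X : set (T -> R)) {E : Type} (leE : E -> E -> Prop)
    (z : E -> (T -> R)) : Prop :=
  [/\ directed leE,
      (forall b, X (z b)),
      (forall b b', leE b b' -> aele (z b') (z b)),
      (forall b, aele (fun _ => 0) (z b)) &
      (forall y, X y -> (forall b, aele y (z b)) -> aele y (fun _ => 0))].

Definition order_conv0 (X : set (T -> R)) {D : Type} (le : D -> D -> Prop)
    (x : D -> (T -> R)) : Prop :=
  (forall a, X (x a)) /\
  exists (E : Type) (leE : E -> E -> Prop) (z : E -> (T -> R)),
    net_decr_to0 X leE z /\
    forall b, exists a0, forall a, le a0 a ->
      aele (fun w => `|x a w|) (z b).

Definition order_continuous (X : set (T -> R)) (phi : (T -> R) -> R) : Prop :=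
  linear_on X phi /\
  forall (D : Type) (le : D -> D -> Prop) (x : D -> (T -> R)),
    directed le -> order_conv0 X le x ->
    forall e : R, 0 < e -> exists a0, forall a, le a0 a -> `|phi (x a)| < e.

Definition weak_closure (X : set (T -> R)) (S : set (T -> R)) : set (T -> R) :=
  fun x => X x /\
    forall (n : nat) (phis : 'I_n -> ((T -> R) -> R)),
      (forall i, order_continuous X (phis i)) ->
      forall e : R, 0 < e ->
        exists c, S c /\ forall i, `|phis i x - phis i c| < e.

Definition strictly_positive (X : set (T -> R)) (phi : (T -> R) -> R) : Prop :=
  forall x, X x -> aele (fun _ => 0) x -> ~ aeeq x (fun _ => 0) -> 0 < phi x.

Definition call (f : T -> R) (k : R) : T -> R := fun w => Num.max (f w - k) 0.

Definition O_span (f : T -> R) : set (T -> R) :=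
  fun x => exists (n : nat) (c : R) (a k : 'I_n -> R),
    aeeq x (fun w => c + \sum_(i < n) a i * call f (k i) w).

Definition positive_on (S : set (T -> R)) (pi : (T -> R) -> R) : Prop :=
  forall x, S x -> aele (fun _ => 0) x -> 0 <= pi x.

Definition M0_minus_Xplus (X M : set (T -> R)) (pi : (T -> R) -> R) : set (T -> R) :=
  fun x => exists m y, M m /\ pi m = 0 /\ X y /\ aele (fun _ => 0) y /\
                       x = m \- y.

Definition no_free_lunch (X M : set (T -> R)) (pi : (T -> R) -> R) : Prop :=
  forall x, weak_closure X (M0_minus_Xplus X M pi) x -> X x ->
    aele (fun _ => 0) x -> aeeq x (fun _ => 0).

Definition consistent_price (X M : set (T -> R)) (pi : (T -> R) -> R)
    (g : T -> R) (p : R) : Prop :=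
  exists xs : (T -> R) -> R,
    [/\ order_continuous X xs, strictly_positive X xs,
        (forall m, M m -> xs m = pi m) & xs g = p].

Definition price_determined (X M : set (T -> R)) (pi : (T -> R) -> R)
    (g : T -> R) : Prop :=
  exists! p : R, consistent_price X M pi g p.

Definition sigma_f (f : T -> R) : set (set T) :=
  smallest (sigma_algebra setT)
    ([set A | exists B : set R, measurable B /\ A = f @^-1` B] `|`
     [set N | measurable N /\ P N = 0%E]).

Definition L0_sigma_f (f : T -> R) : set (T -> R) :=
  fun g => measurable_fun setT g /\
    exists h : T -> R, aeeq h g /\
      forall B : set R, measurable B -> sigma_f f (h @^-1` B).

End Defs.

(* Main.v *)
(* Uniqueness: [n ((f - k)^+ - (f - k - 1/n)^+)] increases to the indicator of
   [f > k], so two consistent functionals, being order continuous, agree on these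
   indicators; by the pi-lambda theorem they agree on the indicators of all sets
   in sigma(f), and by layer-cake approximation on every element of X that is
   sigma(f)-measurable.

   Existence is the Kreps-Yan theorem. Hahn-Banach separation in the
   finite-dimensional quotient given by a weak neighbourhood yields, for each
   x > 0, a positive order continuous functional that vanishes on M_0 and is
   positive at x. Positive functionals on X are bounded, so countably many of them
   can be summed with weights; an exhaustion argument then produces one that is
   strictly positive, and a scaling makes it extend pi. *)
Require Import Defs.
From HB Require Import structures.
From mathcomp Require Import all_boot all_order all_algebra.
From mathcomp Require Import all_classical all_reals all_analysis.
From mathcomp Require Import measurable_realfun ring lra.
Set Implicit Arguments.
Unset Strict Implicit.
Unset Printing Implicit Defensive.
Import Order.TTheory GRing.Theory Num.Theory.
Import numFieldNormedType.Exports.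
Local Open Scope classical_set_scope.
Local Open Scope ring_scope.

(** * Sublinear functionals and Hahn-Banach on row vectors *)

Section Sublinear.
Context {R : realType} {V : lmodType R}.
Implicit Types (p q : V -> R) (x y e : V).

(** Scaling is asked only as an inequality, the form that the infima below satisfy directly; the
    inverse scalar turns it into equality in [sublinearZ]. *)
Definition sublinear p : Prop :=
  [/\ p 0 = 0, forall x y, p (x + y) <= p x + p y &
      forall (t : R) x, 0 < t -> p (t *: x) <= t * p x].

Lemma sublinear_ge p x : sublinear p -> - p (- x) <= p x.
Proof.
by move=> [p0 pD _]; move: (pD x (- x)); rewrite subrr p0; lra.
Qed.

Lemma sublinearZ p (t : R) x : sublinear p -> 0 <= t -> p (t *: x) = t * p x.
Proof.
move=> [p0 pD pZ]; rewrite le_eqVlt => /predU1P[<-|t0].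
  by rewrite scale0r mul0r.
apply/eqP; rewrite eq_le pZ //=.
have := pZ t^-1 (t *: x); rewrite invr_gt0 => /(_ t0).
rewrite scalerA mulVf ?gt_eqF// scale1r -(ler_pM2l t0) mulrA mulfV ?gt_eqF//.
by rewrite mul1r.
Qed.

(* [q x = inf_(t >= 0) (p (x + t e) - t p e)] makes [e] a direction of
   linearity. *)
Lemma sublinear_flatten p e : sublinear p ->
  exists q, [/\ sublinear q, forall x, q x <= p x & q (- e) <= - p e].
Proof.
move=> sp; have [p0 pD pZ] := sp.
pose S x := [set p (x + t *: e) - t * p e | t in [set t : R | 0 <= t]].
(* Subadditivity on [(x + t e) + (- x) = t e] bounds every member of [S x] from below, so its
   infimum is meaningful. *)
have Slb x : lbound (S x) (- p (- x)).
  move=> _ [t /= t0 <-]; rewrite -(sublinearZ _ sp t0).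
  by have := pD (x + t *: e) (- x); rewrite addrAC subrr add0r; lra.
have Sle x t : 0 <= t -> inf (S x) <= p (x + t *: e) - t * p e.
  by move=> t0; apply: ge_inf; [exists (- p (- x)); exact: Slb|exists t].
have Sge x r : (forall t, 0 <= t -> r <= p (x + t *: e) - t * p e) ->
    r <= inf (S x).
  move=> H; apply: lb_le_inf; last by move=> _ [t /= t0 <-]; exact: H.
  by exists (p (x + 0 *: e) - 0 * p e); exists 0 => /=.
exists (fun x => inf (S x)); split; last 2 first.
- by move=> x; have := Sle x 0 (lexx _); rewrite scale0r mul0r addr0 subr0.
- by have := Sle (- e) 1 ler01; rewrite scale1r addNr p0; lra.
split.
- apply/eqP; rewrite eq_le; apply/andP; split.
    by have := Sle 0 0 (lexx _); rewrite scale0r mul0r addr0 subr0 p0.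
  by apply: lb_le_inf; [by exists (p (0 + 0 *: e) - 0 * p e); exists 0 => /=|];
     have := Slb 0; rewrite oppr0 p0 oppr0.
- move=> x y; rewrite -lerBlDl; apply: (Sge y) => s s0.
  rewrite lerBlDl -lerBlDr; apply: (Sge x) => t t0.
  have := Sle (x + y) (t + s) (addr_ge0 t0 s0).
  have := pD (x + t *: e) (y + s *: e).
  by rewrite scalerDl addrACA mulrDl; lra.
- move=> t x t0; rewrite -ler_pdivrMl//; apply: Sge => s s0.
  rewrite ler_pdivrMl//.
  have := Sle (t *: x) (t * s) (mulr_ge0 (ltW t0) s0).
  by rewrite -scalerA -scalerDr (sublinearZ _ sp (ltW t0)); lra.
Qed.

(** Directions are flattened one at a time. An earlier one survives the passage to a smaller
    functional [r <= q <= p]: [r (- e) <= q (- e) <= - p e <= - r e]. *)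
Lemma sublinear_flatten_seq p (s : seq V) : sublinear p ->
  exists q, [/\ sublinear q, forall x, q x <= p x &
    forall e, e \in s -> q (- e) <= - q e].
Proof.
elim: s p => [|e s IH] p sp; first by exists p; split.
have [q [sq qp qe]] := sublinear_flatten e sp.
have [r [sr rq rs]] := IH _ sq.
exists r; split=> // [x|x]; first exact: le_trans (qp x).
rewrite inE => /predU1P[->|/rs//].
have := rq (- e); have := rq e; have := qp e; lra.
Qed.

Lemma sublinear_linear q : sublinear q -> (forall x, q (- x) <= - q x) ->
  forall (a : R) x y, q (a *: x + y) = a * q x + q y.
Proof.
move=> sq qN; have [q0 qD qZ] := sq.
have qNE x : q (- x) = - q x.
  by apply/eqP; rewrite eq_le qN /=; have := sublinear_ge x sq; lra.
have qDE x y : q (x + y) = q x + q y.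
  apply/eqP; rewrite eq_le qD /=.
  by have := qD (x + y) (- y); rewrite addrK qNE; lra.
move=> a x y; rewrite qDE; congr (_ + _).
have [a0|a0] := leP 0 a; first exact: sublinearZ.
rewrite -[a]opprK scaleNr qNE sublinearZ ?oppr_ge0 ?ltW//; lra.
Qed.

End Sublinear.

(** Flattening [v] first fixes the value there, as [q v >= - q (- v) >= p v]. Then the basis vectors
    are flattened; the directions in which [q] is odd are closed under sums and multiples, so [q] is
    odd everywhere and hence linear. *)
Lemma hahn_banach_rV {R : realType} {n : nat} (p : 'rV[R]_n -> R) v :
  sublinear p -> exists q : 'rV[R]_n -> R,
  [/\ forall (a : R) x y, q (a *: x + y) = a * q x + q y,
      forall x, q x <= p x & q v = p v].
Proof.
move=> sp; have [q1 [sq1 q1p q1v]] := sublinear_flatten v sp.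
have [q [sq qq1 qs]] :=
  sublinear_flatten_seq (codom (fun i : 'I_n => 'e_i : 'rV[R]_n)) sq1.
have [q0 qD qZ] := sq.
have odd0 : q (- 0) <= - q 0 by rewrite oppr0 q0 oppr0.
have oddD x y : q (- x) <= - q x -> q (- y) <= - q y ->
    q (- (x + y)) <= - q (x + y).
  by move=> hx hy; have := qD x y; have := qD (- x) (- y); rewrite -opprD; lra.
have oddZ (a : R) x : q (- x) <= - q x -> q (- (a *: x)) <= - q (a *: x).
  move=> hx; have [a0|/ltW a0] := leP 0 a.
    by rewrite -scalerN !(sublinearZ _ sq)//; rewrite -mulrN ler_wpM2l.
  have {}a0 : 0 <= - a by rewrite oppr_ge0.
  have -> : a *: x = - (- a *: x) by rewrite scaleNr opprK.
  rewrite opprK -scalerN !(sublinearZ _ sq)//.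
  by rewrite -mulrN ler_wpM2l// lerNr.
have odd x : q (- x) <= - q x.
  rewrite (row_sum_delta x); elim/big_ind: _ => // i _.
  by apply: oddZ; apply: qs; apply: codom_f.
exists q; split => [||].
- exact: sublinear_linear.
- by move=> x; apply: le_trans (q1p x).
- have := qq1 v; have := q1p v; have := qq1 (- v); have := sublinear_ge v sq.
  by move=> *; apply/eqP; rewrite eq_le; apply/andP; split; lra.
Qed.

(** * Ideals and order continuous functionals *)

Section Ideal.
Context {d : measure_display} {T : measurableType d} {R : realType}.
Variable P : probability T R.
Implicit Types (X : set (T -> R)) (x y z : T -> R) (phi psi : (T -> R) -> R).

Lemma ideal_aeeq X x y : is_ideal P X -> measurable_fun setT x -> X y ->
  aeeq P x y -> X x.
Proof.
move=> [_ _ _ _ XS] mx Xy xy; apply: (XS _ y) => //.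
by apply: filterS xy => w ->.
Qed.

Lemma idealZD X (a : R) x y : is_ideal P X -> X x -> X y ->
  X (fun w => a * x w + y w).
Proof. by move=> [_ _ XD XZ _] Xx Xy; apply: XD => //; exact: XZ. Qed.

Lemma idealB X x y : is_ideal P X -> X x -> X y -> X (x \- y).
Proof.
move=> HX Xx Xy; have := idealZD (-1) HX Xy Xx; congr X.
by apply/funext => w /=; rewrite mulN1r addrC.
Qed.

Lemma ideal_sum X (n : nat) (a : 'I_n -> R) (x : 'I_n -> T -> R) :
  is_ideal P X -> (forall i, X (x i)) ->
  X (fun w => \sum_(i < n) a i * x i w).
Proof.
move=> HX; have [_ X0 _ _ _] := HX.
elim: n a x => [|n IH] a x Xx.
  by move: X0; congr X; apply/funext => w; rewrite big_ord0.
under eq_fun do rewrite big_ord_recl.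
exact: idealZD HX (Xx _) (IH _ _ (fun i => Xx (lift ord0 i))).
Qed.

Lemma linear_on0 X phi : X (fun _ => 0) -> linear_on P X phi ->
  phi (fun _ => 0) = 0.
Proof.
move=> X0 [phiL _]; have := phiL 1 _ _ X0 X0.
under eq_fun do rewrite mulr0 addr0.
lra.
Qed.

Lemma linear_onZ X phi (a : R) x : X (fun _ => 0) -> linear_on P X phi ->
  X x -> phi (fun w => a * x w) = a * phi x.
Proof.
move=> X0 lphi Xx; have := lphi.1 a _ _ Xx X0.
rewrite (linear_on0 X0 lphi) addr0 => <-.
by under [in RHS]eq_fun do rewrite addr0.
Qed.

Lemma linear_onD X phi x y : linear_on P X phi -> X x -> X y ->
  phi (x \+ y) = phi x + phi y.
Proof.
move=> lphi Xx Xy; have := lphi.1 1 _ _ Xx Xy; rewrite mul1r => <-.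
by congr phi; apply/funext => w /=; rewrite mul1r.
Qed.

Lemma linear_onB X phi x y : linear_on P X phi -> X x -> X y ->
  phi (x \- y) = phi x - phi y.
Proof.
move=> lphi Xx Xy; have := lphi.1 (-1) _ _ Xy Xx; rewrite mulN1r addrC => <-.
by congr phi; apply/funext => w /=; rewrite mulN1r addrC.
Qed.

Lemma linear_on_sum X phi (n : nat) (a : 'I_n -> R) (x : 'I_n -> T -> R) :
  is_ideal P X -> linear_on P X phi -> (forall i, X (x i)) ->
  phi (fun w => \sum_(i < n) a i * x i w) = \sum_(i < n) a i * phi (x i).
Proof.
move=> HX lphi; have [_ X0 _ _ _] := HX.
elim: n a x => [|n IH] a x Xx.
  rewrite big_ord0 -[RHS](linear_on0 X0 lphi).
  by congr phi; apply/funext => w; rewrite big_ord0.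
under eq_fun do rewrite big_ord_recl.
rewrite (lphi.1 _ _ _ (Xx _) (ideal_sum _ HX (fun i => Xx (lift ord0 i)))).
by rewrite big_ord_recl; congr (_ + _); exact: IH.
Qed.

Lemma positive_on_le X phi x y : is_ideal P X -> linear_on P X phi ->
  positive_on P X phi -> X x -> X y -> aele P x y -> phi x <= phi y.
Proof.
move=> HX lphi pphi Xx Xy xy; rewrite -subr_ge0 -(linear_onB lphi)//.
apply: pphi; first exact: idealB.
by apply: filterS xy => w /=; rewrite subr_ge0.
Qed.

Lemma directed_finite {D : Type} (le : D -> D -> Prop) (n : nat)
    (Q : 'I_n -> D -> Prop) : directed le ->
  (forall i, exists a0, forall a, le a0 a -> Q i a) ->
  exists a0, forall i a, le a0 a -> Q i a.
Proof.
move=> [[a0 _] lexx ltr lub]; elim: n Q => [|n IH] Q HQ.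
  by exists a0 => -[].
have [b1 H1] := IH (fun i => Q (lift ord0 i)) (fun i => HQ _).
have [b2 H2] := HQ ord0; have [b [b1b b2b]] := lub b1 b2.
exists b => i a ba; case: (unliftP ord0 i) => [j ->|->].
  by apply: H1; exact: ltr ba.
by apply: H2; exact: ltr ba.
Qed.

(** An order convergent net is eventually inside an order interval [[-z, z]], so control there by
    finitely many order continuous functionals, up to an arbitrary error, suffices. Each functional
    constructed below is shown order continuous in this way. *)
Lemma dominated_order_continuous X psi : linear_on P X psi ->
  (forall z (e : R), X z -> 0 < e ->
    exists (n : nat) (phis : 'I_n -> (T -> R) -> R) (K : R),
      [/\ forall i, order_continuous P X (phis i), 0 <= K &
      forall x, X x -> aele P (fun w => `|x w|) z ->
        `|psi x| <= K * \sum_(i < n) `|phis i x| + e]) ->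
  order_continuous P X psi.
Proof.
move=> lpsi dom; split=> // D le x dle ox e e0.
have [Xx [E [leE [z [zE zdom]]]]] := ox.
have [[[b _] _ _ _] Xz _ _ _] := zE.
have [a1 xz] := zdom b.
have e20 : 0 < e / 2 by rewrite divr_gt0.
have [n [phis [K [ophi K0 H]]]] := dom (z b) _ (Xz b) e20.
(* The [+ 1] keeps the divisor positive when [K * n] is zero and makes the final inequality
   strict. *)
have K1 : 0 < K * n%:R + 1.
  by rewrite ltr_wpDl// mulr_ge0.
have [a0 Ha0] : exists a0, forall i a, le a0 a ->
    `|phis i (x a)| <= e / 2 / (K * n%:R + 1).
  apply: (@directed_finite D le n
    (fun i a => `|phis i (x a)| <= e / 2 / (K * n%:R + 1))) => // i.
  have [a0 H0] := (ophi i).2 D le x dle ox _ (divr_gt0 e20 K1).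
  by exists a0 => a /H0/ltW.
have [_ _ ltr lub] := dle.
have [c [ca0 ca1]] := lub a0 a1; exists c => a ca.
apply: (le_lt_trans (H _ (Xx a) (xz a (ltr _ _ _ ca1 ca)))).
have : \sum_(i < n) `|phis i (x a)| <= n%:R * (e / 2 / (K * n%:R + 1)).
  rewrite mulr_natl -[X in _ *+ X]card_ord -sumr_const.
  by apply: ler_sum => i _; apply: Ha0; exact: ltr ca.
move/(ler_wpM2l K0)/le_lt_trans => h.
rewrite -ltrBrDr; apply: h.
have -> : K * (n%:R * (e / 2 / (K * n%:R + 1))) =
  e / 2 * (K * n%:R / (K * n%:R + 1)) by ring.
have -> : e - e / 2 = e / 2 * 1 by field.
rewrite ltr_pM2l// ltr_pdivrMr// mul1r; lra.
Qed.

Lemma order_continuous_sum X (n : nat) (a : 'I_n -> R)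
    (phis : 'I_n -> (T -> R) -> R) :
  (forall i, order_continuous P X (phis i)) ->
  order_continuous P X (fun x => \sum_(i < n) a i * phis i x).
Proof.
move=> ophi; apply: dominated_order_continuous.
  split=> [r x y Xx Xy|x y Xx Xy xy].
    rewrite mulr_sumr -big_split/=; apply: eq_bigr => i _.
    by rewrite ((ophi i).1.1 _ _ _ Xx Xy); ring.
  by apply: eq_bigr => i _; rewrite ((ophi i).1.2 _ _ Xx Xy xy).
move=> z e Xz e0; exists n, phis, (\sum_(i < n) `|a i|); split => //.
  exact: sumr_ge0.
move=> x Xx _; rewrite (le_trans (ler_norm_sum _ _ _))//.
rewrite ler_wpDr ?(ltW e0)// mulr_suml; apply: ler_sum => i _.
rewrite normrM ler_wpM2l// (bigD1 i)//= lerDl; exact: sumr_ge0.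
Qed.

Lemma order_continuous_squeeze X phi (y z : nat -> T -> R) :
  order_continuous P X phi -> (forall n, X (y n)) -> (forall n, X (z n)) ->
  (forall n w, `|y n w| <= z n w) -> (forall n w, z n.+1 w <= z n w) ->
  (forall w (e : R), 0 < e -> exists n, z n w < e) ->
  forall e : R, 0 < e -> exists n, `|phi (y n)| < e.
Proof.
move=> [_ ophi] Xy Xz yz zS zev e e0.
have dN : directed (fun m n : nat => (m <= n)%N).
  split; [by exists 0%N|by []|by move=> a b c; exact: leq_trans|].
  by move=> a b; exists (maxn a b); rewrite leq_maxl leq_maxr.
have zdec m n w : (m <= n)%N -> z n w <= z m w.
  move=> mn; rewrite -(subnK mn); elim: (n - m)%N => // k; rewrite addSn.
  exact: le_trans.
have /(ophi nat _ y dN)/(_ e e0)[n Hn] :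
    order_conv0 P X (fun m n : nat => (m <= n)%N) y.
  split=> //; exists nat, (fun m n : nat => (m <= n)%N), z; split.
    split=> //.
    - by move=> b b' bb'; apply: aeW => w; exact: zdec.
    - by move=> b; apply: aeW => w; exact: le_trans (yz b w).
    (* The index set is countable, so the inequalities [x <= z n] hold together off one null set,
       and there [z n w] gets arbitrarily small. *)
    - move=> x Xx xz; have /ae_foralln := xz; apply: filterS => w xzw.
      apply/ler_addgt0Pl => r r0; rewrite addr0.
      by have [n /ltW] := zev w _ r0; exact: le_trans.
  move=> b; exists b => a ba; apply: aeW => w.
  exact: le_trans (zdec _ _ _ ba).
by exists n; exact: Hn.
Qed.

(** The functions [x - y n] decrease to 0 pointwise, yet [phi] takes the value [phi x] on each of
    them; [order_continuous_squeeze] with [e = |phi x|] is then contradictory. *)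
Lemma order_continuous_vanish X phi x (y : nat -> T -> R) : is_ideal P X ->
  order_continuous P X phi -> X x -> (forall n, X (y n)) ->
  (forall n w, y n w <= y n.+1 w) -> (forall n w, y n w <= x w) ->
  (forall w, exists n, y n w = x w) ->
  (forall n, phi (y n) = 0) -> phi x = 0.
Proof.
move=> HX ophi Xx Xy yS yx yev phiy.
apply/eqP; rewrite -normr_le0 leNgt; apply/negP => e0.
have Xxy n : X (x \- y n) by exact: idealB.
have xy0 n w : 0 <= (x \- y n) w by rewrite subr_ge0.
have xyS n w : (x \- y n.+1) w <= (x \- y n) w by rewrite lerD2l lerN2.
have xyev w : exists n, (x \- y n) w = 0.
  by have [n nw] := yev w; exists n; rewrite /= nw subrr.
have [|w r r0|n] := order_continuous_squeeze ophi Xxy Xxy _ xyS _ e0.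
- by move=> n w; rewrite ger0_norm.
- by have [n nw] := xyev w; exists n; rewrite nw.
- by rewrite (linear_onB ophi.1)// phiy subr0 ltxx.
Qed.

End Ideal.

(** * Indicators and the pi-lambda argument *)

Section Indicators.
Context {d : measure_display} {T : measurableType d} {R : realType}.
Variables (P : probability T R) (X : set (T -> R)).
Hypotheses (HX : is_ideal P X) (Xconst : forall c : R, X (fun _ => c)).

Lemma indic_in (A : set T) w : A w -> \1_A w = 1 :> R.
Proof. by move=> Aw; rewrite indicE mem_set. Qed.

Lemma indic_notin (A : set T) w : ~ A w -> \1_A w = 0 :> R.
Proof. by move=> Aw; rewrite indicE memNset. Qed.

Lemma indic_le (A B : set T) w : A `<=` B -> \1_A w <= \1_B w :> R.
Proof.
move=> AB; have [Aw|nAw] := pselect (A w).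
  by rewrite !indic_in//; exact: AB.
by rewrite (indic_notin nAw) indicE.
Qed.

Lemma ideal_bounded (x : T -> R) (c : R) : measurable_fun setT x ->
  (forall w, `|x w| <= c) -> X x.
Proof.
move=> mx xc; have [_ _ _ _ XS] := HX; apply: (XS _ _ mx (Xconst c)).
by apply: aeW => w; apply: le_trans (ler_norm c).
Qed.

Lemma ideal_indic (A : set T) : measurable A -> X \1_A.
Proof.
move=> mA; apply: (@ideal_bounded _ 1) => [|w]; first exact: measurable_indic.
by rewrite indicE normr_nat lern1; case: (_ \in _).
Qed.

Lemma ideal_norm_le (x y : T -> R) : measurable_fun setT x -> X y ->
  (forall w, `|x w| <= `|y w|) -> X x.
Proof.
by move=> mx Xy xy; have [_ _ _ _ XS] := HX; apply: XS Xy _ => //; exact: aeW.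
Qed.

Lemma order_continuous_bigcup phi (A : nat -> set T) :
  order_continuous P X phi -> (forall n, measurable (A n)) ->
  (forall n, A n `<=` A n.+1) -> (forall n, phi \1_(A n) = 0) ->
  phi \1_(\bigcup_n A n) = 0.
Proof.
move=> ophi mA AS phiA.
apply: (order_continuous_vanish HX ophi (y := fun n => \1_(A n))) => //.
- by apply: ideal_indic; exact: bigcup_measurable.
- by move=> n; exact: ideal_indic.
- by move=> n w; exact: indic_le.
- by move=> n w; apply: indic_le; exact: bigcup_sup.
- move=> w; have [[n _ Aw]|nA] := pselect ((\bigcup_n A n) w).
    by exists n; rewrite !indic_in//; exists n.
  by exists 0%N; rewrite !indic_notin// => A0; apply: nA; exists 0%N.
Qed.

Lemma indic_setD (A B : set T) : B `<=` A ->
  \1_(A `\` B) = \1_A \- \1_B :> (T -> R).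
Proof.
move=> BA; apply/funext => w /=.
have [Bw|nBw] := pselect (B w).
  by rewrite (indic_in Bw) (indic_in (BA _ Bw)) indic_notin ?subrr// => -[].
rewrite (indic_notin nBw) subr0.
have [Aw|nAw] := pselect (A w); first by rewrite !indic_in.
by rewrite !indic_notin// => -[].
Qed.

Lemma aeeq_indic0 (A : set T) : measurable A -> P A = 0%E ->
  aeeq P (\1_A : T -> R) (fun _ => 0).
Proof.
move=> mA PA; exists A; split=> // w /=; apply: contra_notP => nAw.
by rewrite indic_notin.
Qed.

End Indicators.

Section Vanishing.
Context {d : measure_display} {T : measurableType d} {R : realType}.
Variables (P : probability T R) (X : set (T -> R)).
Hypotheses (HX : is_ideal P X) (Xconst : forall c : R, X (fun _ => c)).
Variable phi : (T -> R) -> R.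
Hypothesis ophi : order_continuous P X phi.

Let X0 : X (fun _ => 0). Proof. exact: Xconst. Qed.

Lemma lambda_system_vanish : phi (fun _ => 1) = 0 ->
  lambda_system setT [set A | measurable A /\ phi \1_A = 0].
Proof.
move=> phi1; split=> //.
- by split; [exact: measurableT|rewrite -phi1 indicT].
- move=> A B BA [mA phiA] [mB phiB]; split; first exact: measurableD.
  rewrite indic_setD// (linear_onB ophi.1) ?phiA ?phiB ?subrr//;
  exact: (ideal_indic HX).
- move=> F ndF HF; split; first by apply: bigcup_measurable => n _; case: (HF n).
  apply: (order_continuous_bigcup HX) => // [n|n|n].
  + by case: (HF n).
  + exact/subsetPset/ndF.
  + by case: (HF n).
Qed.

Lemma measurable_call (f : T -> R) k : measurable_fun setT f ->
  measurable_fun setT (call f k).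
Proof.
move=> mf; apply: measurable_maxr; last exact: measurable_cst.
by apply: measurable_funB => //; exact: measurable_cst.
Qed.

Lemma ideal_call (f : T -> R) k : X f -> X (call f k).
Proof.
move=> Xf; apply: (ideal_norm_le HX) (idealB HX Xf (Xconst k)) _.
  by apply: measurable_call; have [+ _ _ _ _] := HX; exact.
move=> w; rewrite /call /=; have [fk|fk] := leP (f w - k) 0.
  by rewrite normr0.
by [].
Qed.

(* [n ((f - k)^+ - (f - k - 1/n)^+) = min (n (f - k)^+) 1] increases to the
   indicator of [f > k]. *)
Lemma vanish_call_ray (f : T -> R) k : X f ->
  (forall k', phi (call f k') = 0) -> phi \1_(f @^-1` `]k, +oo[) = 0.
Proof.
move=> Xf phif.
have mf : measurable_fun setT f by have [+ _ _ _ _] := HX; exact.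
pose y n w : R := n.+1%:R * (call f k \- call f (k + n.+1%:R^-1)) w.
have XB n : X (call f k \- call f (k + n.+1%:R^-1)).
  exact: (idealB HX (ideal_call _ Xf) (ideal_call _ Xf)).
have yE n w : y n w = Num.min (n.+1%:R * Num.max (f w - k) 0) 1.
  rewrite /y /= /call mulrBr opprD addrA.
  have n0 : (0 : R) < n.+1%:R by [].
  have [fk|fk] := leP (f w - k) 0.
    rewrite max_r ?mulr0 ?subr0 ?min_l//.
    by rewrite subr_le0 (le_trans fk)// invr_ge0.
  have [fn|fn] := leP (f w - k) n.+1%:R^-1.
    rewrite max_r ?subr_le0// mulr0 subr0 min_l//.
    by rewrite -ler_pdivlMl// mulr1.
  rewrite max_l ?subr_ge0 1?ltW// min_r.
    by rewrite -mulrBr subKr mulfV.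
  by rewrite -ler_pdivrMl// mulr1 ltW.
apply: (order_continuous_vanish HX ophi (y := y)).
- apply: (ideal_indic HX) => //; rewrite -[X in measurable X]setTI.
  exact: mf.
- by move=> n; have [_ _ _ XZ _] := HX; exact: XZ.
- move=> n w; rewrite !yE.
  apply: le_min2 => //; rewrite ler_wpM2r ?ler_nat// le_max lexx orbT//.
- move=> n w; rewrite yE.
  have [fk|nfk] := pselect ((f @^-1` `]k, +oo[) w).
    by rewrite indic_in// ge_min lexx orbT.
  rewrite indic_notin// max_r ?mulr0 ?ge_min ?lexx// subr_le0 leNgt.
  by apply/negP => fk; apply: nfk; rewrite /= in_itv/= fk.
- move=> w; have [fk|nfk] := pselect ((f @^-1` `]k, +oo[) w).
    rewrite indic_in//; move: fk; rewrite /= in_itv/= andbT => fk.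
    have fk0 : 0 < f w - k by rewrite subr_gt0.
    (* Once [n + 1 >= 1 / (f w - k)] the minimum is exactly 1, so the indicator is attained and not
       merely approached. *)
    exists (Num.bound (f w - k)^-1); rewrite yE max_l ?ltW// min_r//.
    rewrite -ler_pdivrMr// mul1r.
    have /archi_boundP/ltW/le_trans -> // : 0 <= (f w - k)^-1.
      by rewrite invr_ge0 ltW.
    by rewrite ler_nat.
  exists 0%N; rewrite indic_notin// yE max_r ?mulr0 ?min_l// subr_le0 leNgt.
  by apply/negP => fk; apply: nfk; rewrite /= in_itv/= fk.
- move=> n; rewrite (linear_onZ _ X0 ophi.1)// (linear_onB ophi.1) ?phif.
  + by rewrite subrr mulr0.
  + exact: ideal_call.
  + exact: ideal_call.
Qed.

(** The rays [f > k] and the null sets together generate [sigma_f] and are closed under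
    intersection. [phi] vanishes on the former by [vanish_call_ray] and on the latter by
    compatibility with a.e. equality; the pi-lambda theorem does the rest. *)
Lemma vanish_sigma_f (f : T -> R) : X f -> phi (fun _ => 1) = 0 ->
  (forall k, phi (call f k) = 0) ->
  sigma_f P f `<=` [set A | measurable A /\ phi \1_A = 0].
Proof.
move=> Xf phi1 phif.
have mf : measurable_fun setT f by have [+ _ _ _ _] := HX; exact.
pose G : set (set T) := [set A | (exists k, A = f @^-1` `]k, +oo[) \/
  (measurable A /\ P A = 0%E)].
have mray k : measurable (f @^-1` `]k, +oo[).
  by rewrite -[X in measurable X]setTI; exact: mf.
have GI : setI_closed G.
  have null A B : measurable A -> measurable B -> P B = 0%E ->
      measurable (A `&` B) /\ P (A `&` B) = 0%E.
    move=> mA mB PB; have mAB := measurableI _ _ mA mB; split=> //.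
    by apply: (subset_measure0 _ _ _ PB).
  move=> A B [[k ->]|[mA PA]] [[l ->]|[mB PB]].
  - left; exists (Num.max k l); apply/seteqP; split => w /=;
      rewrite !in_itv/= !andbT gt_max; first by move=> [-> ->].
    by move=> /andP[].
  - by right; apply: null.
  - by right; rewrite setIC; apply: null.
  - by right; apply: null.
apply: (@subset_trans _ <<s G >>); last first.
  apply: (lambda_system_subset GI); last by [].
    exact: lambda_system_vanish.
  move=> A [[k ->]|[mA PA]]; first by split=> //; exact: vanish_call_ray.
  split=> //; rewrite -(linear_on0 X0 ophi.1); apply: ophi.1.2 => //.
    exact: (ideal_indic HX).
  exact: aeeq_indic0.
apply: smallest_sub; first exact: smallest_sigma_algebra.
move=> A [[B [mB ->]]|NA]; last by apply: sub_sigma_algebra; right.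
(* Good-set principle: these [C] form a sigma-algebra that contains the open rays, hence all Borel
   sets. *)
have sG : sigma_algebra setT [set C : set R | <<s G >> (f @^-1` C)].
  have [s0 sC sU] := smallest_sigma_algebra setT G.
  split => /=; first by rewrite preimage_set0.
    by move=> C /sC; rewrite !setTD preimage_setC.
  by move=> F FG; rewrite preimage_bigcup; exact: sU.
have : <<s @RGenOInfty.G R >> B.
  exact: (eq_ind _ (fun S : set (set R) => S B) mB _ (RGenOInfty.measurableE R)).
move=> /(_ _ (conj sG _)); apply => C [k ->] /=; apply: sub_sigma_algebra; left.
by exists k.
Qed.

End Vanishing.

(** * Layer-cake approximation and uniqueness *)

(** The sum rounds [min h (m c)] down to a multiple of [c]. The second conjunct, that all layers are
    full while [m c <= h], carries the induction: it gives the value of the sum when the next layer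
    is full or is the one that fails. *)
Lemma layer_cake_bound {R : realType} (c h : R) (m : nat) : 0 < c -> 0 <= h ->
  let s := \sum_(i < m) c * (i.+1%:R * c <= h)%R%:R in
  0 <= Num.min h (m%:R * c) - s <= c /\
  (m%:R * c <= h -> s = m%:R * c).
Proof.
move=> c0 h0 /=; elim: m => [|m [IH1 IH2]].
  by rewrite big_ord0 mul0r min_r// subrr lexx ltW.
rewrite big_ord_recr/=; move: IH1 IH2.
set s := \sum_(i < m) _ => IH1 IH2.
have mS : m.+1%:R * c = m%:R * c + c by rewrite mulrSr mulrDl mul1r.
have [hm|hm] := leP (m.+1%:R * c) h.
  have -> : s = m%:R * c by apply: IH2; apply: le_trans hm; rewrite mS lerDl ltW.
  by rewrite mulr1 mS subrr lexx ltW.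
rewrite mulr0 addr0; split=> //.
move: IH1; have [hm'|hm'] := leP (m%:R * c) h.
  by move=> _; rewrite IH2// subr_ge0 hm'/= lerBlDl -mS ltW.
by [].
Qed.

Section Uniqueness.
Context {d : measure_display} {T : measurableType d} {R : realType}.
Variables (P : probability T R) (X : set (T -> R)).
Hypotheses (HX : is_ideal P X) (Xconst : forall c : R, X (fun _ => c)).

(** Each truncation [min h M] is a uniform limit of staircases built from the superlevel sets, with
    errors bounded by constants of [X] that decrease to 0. The truncations in turn increase to [h]
    and reach it at every point. *)
Lemma vanish_ge0 phi (h : T -> R) : order_continuous P X phi -> X h ->
  (forall w, 0 <= h w) ->
  (forall c, 0 < c -> phi \1_(h @^-1` `[c, +oo[) = 0) -> phi h = 0.
Proof.
move=> ophi Xh h0 phih.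
have mh : measurable_fun setT h by have [+ _ _ _ _] := HX; exact.
have mray c : measurable (h @^-1` `[c, +oo[).
  by rewrite -[X in measurable X]setTI; exact: mh.
have Xmin M : X (fun w => Num.min (h w) M%:R).
  apply: (ideal_norm_le HX) Xh _.
    by apply: measurable_minr => //; exact: measurable_cst.
  by move=> w; rewrite !ger0_norm ?le_min ?h0 ?ler0n// ge_min lexx.
have phimin M : phi (fun w => Num.min (h w) M%:R) = 0.
  pose c n : R := n.+1%:R^-1.
  have c0 n : 0 < c n by rewrite invr_gt0.
  (* [M (n + 1)] layers of height [1 / (n + 1)] end exactly at level [M]. *)
  pose s n := fun w => \sum_(i < (M * n.+1)%N)
    c n * \1_(h @^-1` `[i.+1%:R * c n, +oo[) w.
  have Xs n : X (s n).
    by apply: (ideal_sum _ HX) => i; exact: (ideal_indic HX).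
  have phis n : phi (s n) = 0.
    rewrite (linear_on_sum _ HX ophi.1); last by move=> i; exact: (ideal_indic HX).
    by apply: big1 => i _; rewrite phih ?mulr0// mulr_gt0.
  have ms n w : `|Num.min (h w) M%:R - s n w| <= c n.
    have [+ _] := layer_cake_bound (M * n.+1) (c0 n) (h0 w).
    rewrite natrM -mulrA mulfV// mulr1.
    have -> : s n w = \sum_(i < (M * n.+1)%N) c n * (i.+1%:R * c n <= h w)%R%:R.
      apply: eq_bigr => i _; rewrite indicE; congr (_ * _%:R).
      congr nat_of_bool; apply/idP/idP; rewrite inE /= in_itv/= andbT//.
    by move=> /andP[ms0 msc]; rewrite ger0_norm.
  apply/eqP; rewrite -normr_le0 leNgt; apply/negP => e0.
  have Xms n : X ((fun w => Num.min (h w) M%:R) \- s n) by exact: (idealB HX).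
  have cS n (w : T) : c n.+1 <= c n by rewrite lef_pV2 ?posrE// ler_nat.
  have cev (w : T) e : 0 < e -> exists n, c n < e.
    move=> ee; exists (Num.bound e^-1); rewrite invf_plt ?posrE//.
    have /archi_boundP/lt_le_trans -> // : 0 <= e^-1 by rewrite invr_ge0 ltW.
    by rewrite ler_nat.
  have [n] :=
    order_continuous_squeeze ophi Xms (fun n => Xconst (c n)) ms cS cev e0.
  by rewrite (linear_onB ophi.1)// phis subr0 ltxx.
apply: (order_continuous_vanish HX ophi (y := fun M w => Num.min (h w) M%:R)) => //.
- by move=> n w; rewrite le_min ge_min lexx/= ge_min ler_nat leqnSn orbT.
- by move=> n w; rewrite ge_min lexx.
- move=> w; exists (Num.bound (h w)); rewrite min_l//.
  exact/ltW/archi_boundP.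
Qed.

(** The argument runs on the representative [h], whose preimages lie in [sigma_f]. For [c > 0] the
    sets where its positive or negative part is at least [c] are preimages of rays under [h], so
    [vanish_ge0] applies to both parts. *)
Lemma vanish_L0_sigma_f phi (f g : T -> R) : order_continuous P X phi ->
  X f -> X g -> L0_sigma_f P f g -> phi (fun _ => 1) = 0 ->
  (forall k, phi (call f k) = 0) -> phi g = 0.
Proof.
move=> ophi Xf Xg [_ [h [hg hsf]]] phi1 phif.
have sub := vanish_sigma_f HX Xconst ophi Xf phi1 phif.
have mh : measurable_fun setT h.
  by move=> _ B mB; rewrite setTI; have [] := sub _ (hsf _ mB).
have Xh : X h := ideal_aeeq HX mh Xg hg.
have phi_h B : measurable B -> phi \1_(h @^-1` B) = 0.
  by move=> mB; have [] := sub _ (hsf _ mB).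
pose hp w := Num.max (h w) 0; pose hn w := Num.max (- h w) 0.
have Xhp : X hp.
  apply: (ideal_norm_le HX) Xh _.
    by apply: measurable_maxr => //; exact: measurable_cst.
  move=> w; rewrite /hp; have [|hw] := leP (h w) 0; last by [].
  by rewrite normr0.
have Xhn : X hn.
  apply: (ideal_norm_le HX) Xh _.
    apply: measurable_maxr; last exact: measurable_cst.
    exact: measurableT_comp.
  move=> w; rewrite /hn; have [|hw] := leP (- h w) 0; first by rewrite normr0.
  by rewrite normrN.
have -> : phi g = phi h by apply/esym/ophi.1.2.
have -> : h = hp \- hn.
  apply/funext => w; rewrite /= /hp /hn.
  have [hw|hw] := leP (h w) 0.
    by rewrite max_l ?oppr_ge0// sub0r opprK.
  by rewrite max_r ?subr0// oppr_le0 ltW.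
have phip : phi hp = 0.
  apply: vanish_ge0 => // [w|c c0]; first by rewrite /hp le_max lexx orbT.
  have -> : hp @^-1` `[c, +oo[ = h @^-1` `[c, +oo[; last exact: phi_h.
  apply/seteqP; split => w; rewrite /= !in_itv/= !andbT /hp le_max.
    by move=> /orP[//|]; rewrite leNgt c0.
  by move=> ->.
have phin : phi hn = 0.
  apply: vanish_ge0 => // [w|c c0]; first by rewrite /hn le_max lexx orbT.
  have -> : hn @^-1` `[c, +oo[ = h @^-1` `]-oo, (- c)]; last exact: phi_h.
  apply/seteqP; split => w; rewrite /= !in_itv/= !andbT /hn le_max lerNr.
    by move=> /orP[//|]; rewrite leNgt c0.
  by move=> ->.
by rewrite (linear_onB ophi.1)// phip phin subrr.
Qed.

Lemma O_span_const f (c : R) : O_span P f (fun _ => c).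
Proof.
exists 0%N, c, (fun _ => 0), (fun _ => 0); apply: aeW => w.
by rewrite big_ord0 addr0.
Qed.

Lemma O_span_call f k : O_span P f (call f k).
Proof.
exists 1%N, 0, (fun _ => 1), (fun _ => k); apply: aeW => w.
by rewrite big_ord1 add0r mul1r.
Qed.

Lemma consistent_price_unique pi (f g : T -> R) (p q : R) : X f -> X g ->
  L0_sigma_f P f g -> consistent_price P X (O_span P f) pi g p ->
  consistent_price P X (O_span P f) pi g q -> p = q.
Proof.
move=> Xf Xg gf [xs [oxs _ xspi <-]] [ys [oys _ yspi <-]].
(* The difference [xs - ys] is written as a two-term combination so that [order_continuous_sum]
   applies. *)
pose phis (i : 'I_2) := if i == 0 then xs else ys.
pose a (i : 'I_2) : R := if i == 0 then 1 else - 1.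
have phiE x : \sum_(i < 2) a i * phis i x = xs x - ys x.
  by rewrite big_ord_recl big_ord1/= mul1r mulN1r.
have ophi : order_continuous P X (fun x => \sum_(i < 2) a i * phis i x).
  by apply: order_continuous_sum => i; rewrite /phis; case: ifP.
apply/eqP; rewrite -subr_eq0 -phiE; apply/eqP.
apply: (vanish_L0_sigma_f ophi Xf Xg gf).
  by rewrite phiE xspi ?yspi ?subrr//; exact: O_span_const.
by move=> k; rewrite phiE xspi ?yspi ?subrr//; exact: O_span_call.
Qed.

End Uniqueness.

(** * Positive functionals on a Banach function space *)

Lemma half_series_bound {R : realType} (u : nat -> R) (C : R) :
  (forall n, `|u n| <= 2^-1 ^+ n * C) ->
  cvgn (series u) /\
  forall n, `|limn (series u) - series u n| <= 2 * 2^-1 ^+ n * C.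
Proof.
move=> uC.
have C0 : 0 <= C by have := uC 0%N; rewrite expr0 mul1r; exact: le_trans.
have h0 : (0 : R) <= 2^-1 by rewrite invr_ge0.
have cu : cvgn (series u).
  apply: normed_cvg; apply: (@series_le_cvg _ _ (geometric C 2^-1)).
  - by move=> n; exact: normr_ge0.
  - by move=> n; rewrite /geometric /= mulr_ge0// exprn_ge0.
  - by move=> n; rewrite /geometric /= mulrC.
  - by apply: is_cvg_geometric_series; rewrite ger0_norm// invf_lt1// ltr1n.
split=> // n.
(* Keeping the exact value of the finite geometric sum lets the induction close; dropping its
   negative term later gives a bound uniform in [k]. *)
have H k : `|series u (n + k)%N - series u n| <=
    (2 * 2^-1 ^+ n - 2 * 2^-1 ^+ (n + k)) * C.
  elim: k => [|k IH]; first by rewrite addn0 !subrr normr0 mul0r.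
  rewrite addnS; have -> : series u (n + k).+1 = series u (n + k)%N + u (n + k)%N.
    by rewrite /series /= big_nat_recr.
  rewrite addrAC (le_trans (ler_normD _ _))//.
  apply: (le_trans (lerD IH (uC _))); rewrite exprS; lra.
have cdist : `|series u m - series u n| @[m --> \oo] -->
    `|limn (series u) - series u n|.
  by apply: cvg_norm; apply: cvgB => //; exact: cvg_cst.
rewrite -(cvg_lim _ cdist)//; apply: limr_le.
  by apply/cvg_ex; eexists; exact: cdist.
near=> m.
have nm : (n <= m)%N by near: m; exact: nbhs_infty_ge.
rewrite -(subnKC nm); apply: (le_trans (H _)); apply: ler_wpM2r => //.
by rewrite lerBlDr lerDl mulr_ge0// exprn_ge0.
Unshelve. all: by end_near.
Qed.

Section BanachFunctionSpace.
Context {d : measure_display} {T : measurableType d} {R : realType}.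
Variables (P : probability T R) (X : set (T -> R)) (N : (T -> R) -> R).
Hypothesis HXN : banach_function_space P X N.

Let HX : is_ideal P X. Proof. by case: HXN. Qed.
Let X0 : X (fun _ => 0). Proof. by case: HX. Qed.

(** Nonnegativity comes from [0 = N (x - x) <= N x + N (- x) = 2 N x]. *)
Lemma bfs_norm_ge0 x : X x -> 0 <= N x.
Proof.
move=> Xx; have [_ [ND NZ _ _ _]] := HXN.
have := ND _ _ Xx (idealB HX X0 Xx).
have -> : x \+ ((fun=> 0) \- x) = (fun w => 0 * x w).
  by apply/funext => w /=; lra.
have -> : N ((fun=> 0) \- x) = N x.
  rewrite -[RHS]mul1r -[1 in RHS]normr1 -normrN -NZ//; congr N.
  by apply/funext => w /=; lra.
by rewrite NZ// normr0 mul0r; lra.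
Qed.

Lemma ideal_abs x : X x -> X (fun w => `|x w|).
Proof.
move=> Xx; have mx : measurable_fun setT x by have [+ _ _ _ _] := HX; exact.
apply: (ideal_norm_le HX) Xx _; first exact: measurableT_comp.
by move=> w; rewrite normr_id.
Qed.

Lemma bfs_norm_abs x : X x -> N (fun w => `|x w|) = N x.
Proof.
move=> Xx; have [_ [_ _ _ Nle _]] := HXN; have Xa := ideal_abs Xx.
by apply/eqP; rewrite eq_le !Nle//; apply: aeW => w; rewrite normr_id.
Qed.

(* The partial sums increase, so their norm limit is an upper bound of them. *)
Lemma bfs_series_upper_bound (y : nat -> T -> R) : (forall n, X (y n)) ->
  (forall n w, 0 <= y n w) -> (forall n, N (y n) <= 2^-1 ^+ n) ->
  exists x, X x /\ forall n, aele P (y n) x.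
Proof.
move=> Xy y0 Ny; have [_ [ND NZ N0 Nle Ncomp]] := HXN.
have [_ _ XD XZ _] := HX.
pose u n w := \sum_(k < n) y k w.
have uS n : u n.+1 = u n \+ y n by apply/funext => w; rewrite /u big_ord_recr.
have Xu n : X (u n).
  elim: n => [|n IH]; last by rewrite uS; exact: XD.
  by move: X0; congr X; apply/funext => w; rewrite /u big_ord0.
have umono n k w : u n w <= u (n + k)%N w.
  elim: k => [|k IH]; first by rewrite addn0.
  by rewrite addnS uS (le_trans IH)//= lerDl.
have h0 : (0 : R) <= 2^-1 by rewrite invr_ge0.
have Nu n k : N (u (n + k)%N \- u n) <= 2 * 2^-1 ^+ n - 2 * 2^-1 ^+ (n + k).
  elim: k => [|k IH].
    rewrite addn0 subrr; have -> : u n \- u n = (fun w => 0 * u n w).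
      by apply/funext => w /=; lra.
    by rewrite NZ// normr0 mul0r.
  rewrite addnS uS.
  have -> : (u (n + k)%N \+ y (n + k)%N) \- u n =
      (u (n + k)%N \- u n) \+ y (n + k)%N by apply/funext => w /=; lra.
  apply: (le_trans (ND _ _ (idealB HX (Xu _) (Xu _)) (Xy _))).
  apply: (le_trans (lerD IH (Ny _))); rewrite exprS; lra.
have cauchy e : 0 < e -> exists n0, forall m n, (n0 <= m)%N -> (n0 <= n)%N ->
    N (u m \- u n) < e.
  move=> e0.
  have : 2 * 2^-1 ^+ n @[n --> \oo] --> (2 * 0 : R).
    by apply: cvgMr; apply: cvg_expr; rewrite ger0_norm// invf_lt1// ltr1n.
  rewrite mulr0 => /cvgrPdist_lt/(_ _ e0)[n0 _ Hn0]; exists n0.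
  have main n k : (n0 <= n)%N -> N (u (n + k)%N \- u n) < e.
    move=> /Hn0; rewrite /= sub0r normrN ger0_norm ?mulr_ge0 ?exprn_ge0//.
    apply: le_lt_trans; apply: (le_trans (Nu _ _)).
    by rewrite lerBlDr lerDl mulr_ge0// exprn_ge0.
  move=> m n n0m n0n; have [mn|/ltnW mn] := leqP n m.
    by rewrite -(subnKC mn); exact: main.
  rewrite -bfs_norm_abs; last exact: (idealB HX).
  have -> : (fun w => `|(u m \- u n) w|) = (fun w => `|(u n \- u m) w|).
    by apply/funext => w /=; rewrite distrC.
  rewrite bfs_norm_abs; last exact: (idealB HX).
  by rewrite -(subnKC mn); exact: main.
have [x [Xx ux]] := Ncomp u Xu cauchy.
exists x; split=> // n.
(* By monotonicity of the partial sums, [v <= |u (n + 1 + m) - x|] for every [m], so [N v = 0] and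
   [u (n + 1) <= x] a.e. *)
pose v w := Num.max (u n.+1 w - x w) 0.
have Xv : X v.
  apply: (ideal_norm_le HX) (idealB HX (Xu n.+1) Xx) _.
    apply: measurable_maxr; last exact: measurable_cst.
    by apply: measurable_funB; have [+ _ _ _ _] := HX; exact.
  move=> w; rewrite /v /=; have [//|] := leP (u n.+1 w - x w) 0.
    by rewrite normr0.
  by [].
have Nv : N v = 0.
  apply/eqP; rewrite eq_le bfs_norm_ge0// andbT.
  apply/ler_addgt0Pl => e e0; rewrite addr0; have [m Hm] := ux e e0.
  have /Hm/ltW : (m <= n.+1 + m)%N by rewrite leq_addl.
  apply: le_trans; apply: Nle => //; first exact: (idealB HX).
  apply: aeW => w; rewrite /v /=.
  have := umono n.+1 m w; have [ux0|ux0] := leP (u n.+1 w - x w) 0.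
    by rewrite normr0.
  by move=> um; rewrite !ger0_norm; lra.
have /(N0 _ Xv) := Nv; apply: filterS => w; rewrite /v => vw.
have : u n.+1 w - x w <= 0 by rewrite -vw le_max lexx.
rewrite uS /=; have : 0 <= u n w by apply: sumr_ge0.
lra.
Qed.

(** If no bound exists, some [x n] satisfy [|phi (x n)| > n 2^n N (x n)]. The rescaled
    [y n = 2^-n |x n| / N (x n)] have a common upper bound [z] in [X], while
    [n < phi (y n) <= phi z] for all [n]. *)
Lemma positive_bounded phi : linear_on P X phi -> positive_on P X phi ->
  exists K, 0 <= K /\ forall x, X x -> `|phi x| <= K * N x.
Proof.
move=> lphi pphi; apply: contrapT => nK.
have [_ [ND NZ N0 Nle _]] := HXN; have [_ _ _ XZ _] := HX.
have ex (n : nat) : exists x, X x /\ n%:R * 2 ^+ n * N x < `|phi x|.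
  apply: contrapT => nx; apply: nK; exists (n%:R * 2 ^+ n).
  split=> [|x Xx]; first by rewrite mulr_ge0// exprn_ge0.
  by rewrite leNgt; apply/negP => xlt; apply: nx; exists x.
have [x Hx] := choice ex.
have Xx n : X (x n) by case: (Hx n).
have xphi n : n%:R * 2 ^+ n * N (x n) < `|phi (x n)| by case: (Hx n).
have Nx n : 0 < N (x n).
  rewrite lt_def bfs_norm_ge0// andbT; apply/negP => /eqP Nx0.
  have := xphi n; rewrite Nx0 mulr0; have /(N0 _ (Xx n)) := Nx0.
  move/(lphi.2 _ _ (Xx n) X0) => ->.
  by rewrite (linear_on0 X0 lphi) normr0 ltxx.
pose a n := 2^-1 ^+ n / N (x n).
have a0 n : 0 <= a n by rewrite divr_ge0 ?ltW// exprn_gt0// invr_gt0.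
pose y n w := a n * `|x n w|.
have Xy n : X (y n) by apply: XZ; exact: ideal_abs.
have [|n|z [Xz yz]] := @bfs_series_upper_bound y Xy.
- by move=> n w; rewrite mulr_ge0.
- rewrite NZ; last exact: ideal_abs.
  by rewrite bfs_norm_abs// ger0_norm// divfK// gt_eqF.
have phiy n : n%:R < phi (y n).
  rewrite (linear_onZ _ X0 lphi); last exact: ideal_abs.
  have phixa : `|phi (x n)| <= phi (fun w => `|x n w|).
    have Xa := ideal_abs (Xx n).
    rewrite ler_norml -mulN1r -(linear_onZ _ X0 lphi)//.
    rewrite !(positive_on_le HX lphi pphi)//; try exact: XZ.
      by apply: aeW => w; exact: ler_norm.
    by apply: aeW => w; rewrite mulN1r lerNl -normrN ler_norm.
  have /le_lt_trans : n%:R <= a n * (n%:R * 2 ^+ n * N (x n)).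
    have Nx0 : N (x n) != 0 by rewrite gt_eqF.
    have t0 : 2 ^+ n != 0 :> R by rewrite expf_neq0.
    by rewrite /a exprVn (_ : _ * _ = n%:R)//; field; rewrite Nx0 t0.
  apply; rewrite ltr_pM2l; last by rewrite divr_gt0// exprn_gt0// invr_gt0.
  exact: lt_le_trans phixa.
have := positive_on_le HX lphi pphi (Xy (Num.bound `|phi z|)) Xz (yz _).
rewrite leNgt => /negP; apply.
apply: (le_lt_trans (ler_norm _)); apply: lt_trans (phiy _).
exact: archi_boundP.
Qed.

End BanachFunctionSpace.

(** * Separation and sums of pricing functionals *)

Section Separation.
Context {d : measure_display} {T : measurableType d} {R : realType}.
Variables (P : probability T R) (X : set (T -> R)).
Hypothesis HX : is_ideal P X.

(* On [R^n], [p y = inf_(c in S) |y - (phis c)|_1] is sublinear, vanishes on the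
   cone and is positive at the point to be separated. *)
Lemma weak_closure_separation (S : set (T -> R)) (v : T -> R) :
  S (fun _ => 0) ->
  (forall x y, S x -> S y -> S (x \+ y)) ->
  (forall (t : R) x, 0 < t -> S x -> S (fun w => t * x w)) ->
  X v -> ~ weak_closure P X S v ->
  exists psi, [/\ order_continuous P X psi, 0 < psi v &
    forall c, S c -> X c -> psi c <= 0].
Proof.
move=> S0 SD SZ Xv nv; apply: contrapT => npsi; apply: nv.
split=> // n phis ophi e e0.
apply: contrapT => nc; apply: npsi.
have [_ X0 XD XZ _] := HX.
pose row x : 'rV[R]_n := \row_i phis i x.
pose dist (y : 'rV[R]_n) c := \sum_i `|y 0 i - phis i c|.
(* Only the members of [S] inside [X] are used, since the [phis] are linear there. *)
pose D y := [set dist y c | c in [set c | S c /\ X c]].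
have D0 y : lbound (D y) 0 by move=> _ [c _ <-]; exact: sumr_ge0.
have Dle y c : S c -> X c -> inf (D y) <= dist y c.
  by move=> Sc Xc; apply: ge_inf; [exists 0; exact: D0|exists c].
have Dge y r : (forall c, S c -> X c -> r <= dist y c) -> r <= inf (D y).
  move=> H; apply: lb_le_inf; last by move=> _ [c [Sc Xc] <-]; exact: H.
  by exists (dist y (fun _ => 0)), (fun _ => 0).
have phiD i x y : X x -> X y -> phis i (x \+ y) = phis i x + phis i y.
  exact: linear_onD (ophi i).1.
have phiZ i (t : R) x : X x -> phis i (fun w => t * x w) = t * phis i x.
  exact: linear_onZ X0 (ophi i).1.
have phi0 i : phis i (fun _ => 0) = 0 := linear_on0 X0 (ophi i).1.
have sp : sublinear (fun y => inf (D y)).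
  split.
  - apply/eqP; rewrite eq_le; apply/andP; split; last first.
      by apply: Dge => c _ _; exact: sumr_ge0.
    apply: (le_trans (Dle 0 _ S0 X0)); rewrite /dist big1// => i _.
    by rewrite mxE phi0 subrr normr0.
  - move=> x y; rewrite -lerBlDl; apply: (Dge y) => c Sc Xc.
    rewrite lerBlDl -lerBlDr; apply: (Dge x) => b Sb Xb.
    rewrite lerBlDr; apply: (le_trans (Dle _ _ (SD _ _ Sb Sc) (XD _ _ Xb Xc))).
    rewrite /dist -big_split/=; apply: ler_sum => i _.
    by rewrite mxE phiD// opprD addrACA ler_normD.
  - move=> t x t0; rewrite -ler_pdivrMl//; apply: (Dge x) => c Sc Xc.
    rewrite ler_pdivrMl//; apply: (le_trans (Dle _ _ (SZ _ _ t0 Sc) (XZ _ _ Xc))).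
    rewrite /dist mulr_sumr; apply: ler_sum => i _.
    by rewrite mxE phiZ// -mulrBr normrM gtr0_norm.
have [q [qL qp qv]] := hahn_banach_rV (row v) sp.
have rowL (a : R) x y : X x -> X y ->
    row (fun w => a * x w + y w) = a *: row x + row y.
  by move=> Xx Xy; apply/rowP => i; rewrite !mxE (ophi i).1.1.
have q0 : q 0 = 0 by have := qL 1 0 0; rewrite scaler0 addr0; lra.
have qN y : q (- y) = - q y.
  by have := qL (-1) y 0; rewrite scaleN1r !addr0 q0; lra.
(* As 0 belongs to [S], [q] is bounded by the l1 norm; this is the domination that makes [q (row x)]
   order continuous. *)
have qnorm y : q y <= \sum_i `|y 0 i|.
  apply: (le_trans (qp y)); apply: (le_trans (Dle _ _ S0 X0)).
  by apply: ler_sum => i _; rewrite phi0 subr0.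
exists (fun x => q (row x)); split.
- apply: dominated_order_continuous.
    split=> [a x y Xx Xy|x y Xx Xy xy]; first by rewrite rowL// qL.
    by congr q; apply/rowP => i; rewrite !mxE; exact: (ophi i).1.2.
  move=> z r Xz r0; exists n, phis, 1; split=> // x Xx _.
  rewrite mul1r ler_wpDr ?(ltW r0)// ler_norml lerNl -qN.
  apply/andP; split; apply: (le_trans (qnorm _)); apply: ler_sum => i _;
    by rewrite !mxE ?normrN.
(* Each [c] misses [v] by at least [e] in some coordinate, hence also in l1 distance. *)
- rewrite qv; apply: lt_le_trans e0 _; apply: Dge => c Sc Xc.
  apply: contrapT => /negP; rewrite -ltNge => far; apply: nc.
  exists c; split=> // i; apply: le_lt_trans far.
  by rewrite /dist (bigD1 i)//= mxE lerDl; exact: sumr_ge0.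
- move=> c Sc Xc; apply: (le_trans (qp _)); apply: (le_trans (Dle _ _ Sc Xc)).
  by rewrite /dist big1// => i _; rewrite mxE subrr normr0.
Qed.

End Separation.

Section KrepsYan.
Context {d : measure_display} {T : measurableType d} {R : realType}.
Variables (P : probability T R) (X : set (T -> R)) (N : (T -> R) -> R).
Hypothesis HXN : banach_function_space P X N.
Variables (M : set (T -> R)) (pi : (T -> R) -> R).
Hypotheses (MC : forall c : R, M (fun _ => c))
  (ML : forall (a : R) x y, M x -> M y -> M (fun w => a * x w + y w))
  (lpi : linear_on P M pi).

Let HX : is_ideal P X. Proof. by case: HXN. Qed.
Let X0 : X (fun _ => 0). Proof. by case: HX. Qed.

(** Vanishing on the zero-price claims is asked instead of extending [pi]: it is stable under
    weighted countable sums, and one scaling at the end recovers [pi]. *)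
Definition pricing (phi : (T -> R) -> R) : Prop :=
  [/\ order_continuous P X phi, positive_on P X phi &
      forall m, M m -> X m -> pi m = 0 -> phi m = 0].

(** A nonzero [x >= 0] is outside the weak closure of the cone, hence can be separated from it.
    Being at most 0 on the cone, the separating functional is positive (test [- y]) and vanishes on
    zero-price claims (test [m] and [- m]). *)
Lemma no_free_lunch_pricing x : no_free_lunch P X M pi ->
  X x -> aele P (fun _ => 0) x -> ~ aeeq P x (fun _ => 0) ->
  exists phi, pricing phi /\ 0 < phi x.
Proof.
move=> nfl Xx x0 nx0.
have M0 := MC 0; have pi0 : pi (fun _ => 0) = 0 := linear_on0 M0 lpi.
have [_ _ XD XZ _] := HX.
have MZ (a : R) m : M m -> M (fun w => a * m w).
  by move=> Mm; have := ML a Mm M0; under eq_fun do rewrite addr0.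
have MD m m' : M m -> M m' -> M (m \+ m').
  by move=> Mm Mm'; have := ML 1 Mm Mm'; under eq_fun do rewrite mul1r.
have Mdiff m y : M m -> pi m = 0 -> X y -> aele P (fun _ => 0) y ->
  M0_minus_Xplus P X M pi (m \- y) by move=> *; exists m, y.
have X00 : aele P (fun _ => 0 : R) (fun _ => 0) by apply: aeW.
have MX m : M m -> pi m = 0 -> M0_minus_Xplus P X M pi m.
  move=> Mm pim; have := Mdiff _ _ Mm pim X0 X00.
  by congr (M0_minus_Xplus _ _ _ _ _); apply/funext => w /=; rewrite subr0.
pose S := M0_minus_Xplus P X M pi.
have S0 : S (fun _ => 0) by exact: MX.
have SD y z : S y -> S z -> S (y \+ z).
  move=> [m [y1 [Mm [pim [Xy [y0 ->]]]]]] [m' [y2 [Mm' [pim' [Xy' [y0' ->]]]]]].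
  have -> : (m \- y1) \+ (m' \- y2) = (m \+ m') \- (y1 \+ y2).
    by apply/funext => w /=; lra.
  apply: Mdiff; first exact: MD.
  - by rewrite (linear_onD lpi)// pim pim' addr0.
  - exact: XD.
  - by apply: filterS2 y0 y0' => w ? ? /=; exact: addr_ge0.
have SZ (t : R) y : 0 < t -> S y -> S (fun w => t * y w).
  move=> t0 [m [z [Mm [pim [Xz [z0 ->]]]]]].
  have -> : (fun w => t * (m \- z) w) = (fun w => t * m w) \- (fun w => t * z w).
    by apply/funext => w /=; rewrite mulrBr.
  apply: Mdiff; first exact: MZ.
  - by rewrite (linear_onZ _ M0 lpi)// pim mulr0.
  - exact: XZ.
  - by apply: filterS z0 => w ?; rewrite mulr_ge0// ltW.
have nS : ~ weak_closure P X S x by move=> /nfl/(_ Xx x0)/nx0.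
have [psi [opsi psix psiS]] := weak_closure_separation HX S0 SD SZ Xx nS.
exists psi; split=> //; split=> // [y Xy y0|m Mm Xm pim].
  have := psiS _ (Mdiff _ _ M0 pi0 Xy y0) (idealB HX X0 Xy).
  by rewrite (linear_onB opsi.1)// (linear_on0 X0 opsi.1) sub0r oppr_le0.
apply/eqP; rewrite eq_le (psiS _ (MX _ Mm pim) Xm)/=.
have := psiS (fun w => - 1 * m w); rewrite (linear_onZ _ X0 opsi.1)//.
rewrite mulN1r oppr_le0; apply; last exact: XZ.
by apply: MX; [exact: MZ|rewrite (linear_onZ _ M0 lpi)// pim mulr0].
Qed.

(* Bounded positive functionals can be added up with geometric weights. *)
Lemma pricing_countable_sum (phis : nat -> (T -> R) -> R) :
  (forall n, pricing (phis n)) ->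
  exists psi, pricing psi /\ forall n x, X x -> aele P (fun _ => 0) x ->
    psi x = 0 -> phis n x = 0.
Proof.
move=> pphis.
have lphi n : linear_on P X (phis n) by case: (pphis n) => -[].
have pphi n : positive_on P X (phis n) by case: (pphis n).
have [K HK] := choice (fun n => positive_bounded HXN (lphi n) (pphi n)).
have K0 n : 0 <= K n by case: (HK n).
(* With these weights the [n]-th term is at most [2^-n N x] in absolute value; [1 + K n] cannot be
   zero. *)
pose c n := 2^-1 ^+ n / (1 + K n).
have h0 n : 0 < 2^-1 ^+ n :> R by rewrite exprn_gt0// invr_gt0.
have c0 n : 0 < c n by rewrite divr_gt0// ltr_wpDr.
pose u x n := c n * phis n x.
have uN x n : X x -> `|u x n| <= 2^-1 ^+ n * N x.
  move=> Xx; rewrite normrM gtr0_norm// /c -mulrA ler_pM2l//.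
  rewrite ler_pdivrMl ?ltr_wpDr//; have [_ /(_ x Xx)] := HK n.
  move/le_trans; apply; apply: ler_wpM2r; first exact: (bfs_norm_ge0 HXN).
  by rewrite lerDr.
have cu x : X x -> cvgn (series (u x)).
  by move=> Xx; have [+ _] := half_series_bound (uN x ^~ Xx).
pose psi x := limn (series (u x)).
have lpsi : linear_on P X psi.
  split=> [a x y Xx Xy|x y Xx Xy xy].
    apply/cvg_lim => //.
    have -> : series (u (fun w => a * x w + y w)) =
        (fun n => a * series (u x) n + series (u y) n).
      apply/funext => n; rewrite /series/= mulr_sumr -big_split/=.
      by apply: eq_bigr => i _; rewrite /u (lphi i).1//; ring.
    by apply: cvgD; [apply: cvgMr|]; exact: cu.
  rewrite /psi; congr (limn (series _)); apply/funext => n.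
  by rewrite /u ((lphi n).2 _ _ Xx Xy xy).
have u_ge0 x n : X x -> aele P (fun _ => 0) x -> 0 <= u x n.
  by move=> Xx x0; rewrite mulr_ge0 ?(ltW (c0 n))//; exact: pphi.
have useries x n : X x -> aele P (fun _ => 0) x -> series (u x) n <= psi x.
  move=> Xx x0; apply: nondecreasing_cvgn_le; last exact: cu.
  by apply: nondecreasing_series => k _ _; exact: u_ge0.
exists psi; split; [split|].
- apply: dominated_order_continuous => // z e Xz e0.
  (* The tail bound is uniform over [|x| <= z], because [N x <= N z]; the finitely many earlier
     terms dominate the rest. *)
  have [n Hn] : exists n, 2 * 2^-1 ^+ n * N z < e.
    have : 2 * 2^-1 ^+ n * N z @[n --> \oo] --> (2 * 0 * N z : R).
      apply: cvgMl; apply: cvgMr; apply: cvg_expr.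
      by rewrite ger0_norm ?invr_ge0// invf_lt1// ltr1n.
    rewrite mulr0 mul0r => /cvgrPdist_lt/(_ _ e0)[n _ Hn]; exists n.
    have := Hn n (leqnn n); rewrite /= sub0r normrN.
    exact: le_lt_trans (ler_norm _).
  exists n, (fun i : 'I_n => phis i), (\sum_(i < n) c i); split.
  + by move=> i; case: (pphis i).
  + by apply: sumr_ge0 => i _; exact: ltW.
  move=> x Xx xz.
  have Nxz : N x <= N z.
    have [_ [_ _ _ Nle _]] := HXN; apply: Nle => //.
    by apply: filterS xz => w xzw; apply: le_trans (ler_norm _).
  have [_ /(_ n) tail] := half_series_bound (uN x ^~ Xx).
  rewrite -[psi x](subrK (series (u x) n)) addrC (le_trans (ler_normD _ _))//.
  apply: lerD; last first.
    apply: (le_trans tail); apply: le_trans (ltW Hn); exact: ler_wpM2l.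
  rewrite /series/= big_mkord (le_trans (ler_norm_sum _ _ _))// mulr_suml.
  apply: ler_sum => i _; rewrite normrM gtr0_norm// ler_pM2l//.
  by rewrite (bigD1 i)//= lerDl; exact: sumr_ge0.
- move=> x Xx x0; apply: le_trans (useries x 0%N Xx x0).
  by rewrite /series/= big_geq.
- move=> m Mm Xm pim; rewrite /psi.
  have -> : u m = fun _ => 0.
    by apply/funext => n; rewrite /u; case: (pphis n) => _ _ ->//; rewrite mulr0.
  have -> : series (fun _ : nat => 0 : R) = fun _ => 0.
    by apply/funext => n; rewrite /series/= big1.
  exact: lim_cst.
- move=> n x Xx x0 psix; have := useries x n.+1 Xx x0; rewrite psix => s0.
  have : u x n <= 0.
    apply: le_trans s0; rewrite /series/= big_nat_recr//= lerDr.
    by apply: sumr_ge0 => i _; exact: u_ge0.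
  rewrite /u pmulr_rle0// => phix.
  by apply/eqP; rewrite eq_le phix; exact: pphi.
Qed.

End KrepsYan.

(** * Exhaustion and the Kreps-Yan theorem *)

(** The union of a maximizing sequence attains the supremum of the measures, so adjoining any
    further member cannot increase its measure. *)
Lemma essential_bigcup {d : measure_display} {T : measurableType d}
    {R : realType} (P : probability T R) (C : set (set T)) :
  C `<=` measurable -> C !=set0 ->
  (forall F : nat -> set T, (forall n, C (F n)) -> C (\bigcup_n F n)) ->
  exists A, C A /\ forall B, C B -> P (B `\` A) = 0%E.
Proof.
move=> mC [A0 CA0] CU.
pose S := [set fine (P A) | A in C].
have PfE A : C A -> (fine (P A))%:E = P A.
  by move=> CA; rewrite fineK// fin_num_measure//; exact: mC.
have supS : has_sup S.
  split; first by exists (fine (P A0)), A0.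
  exists 1 => _ [A CA <-]; rewrite -lee_fin PfE//.
  by apply: probability_le1; exact: mC.
have ex (n : nat) : exists A, C A /\ sup S - n.+1%:R^-1 < fine (P A).
  have n0 : (0 : R) < n.+1%:R^-1 by rewrite invr_gt0.
  by have [_ [A CA <-] h] := sup_adherent n0 supS; exists A.
have [F HF] := choice ex.
have CF n : C (F n) by case: (HF n).
pose A := \bigcup_n F n.
have CA : C A := CU _ CF.
have supA : sup S <= fine (P A).
  apply/ler_addgt0Pl => e e0; rewrite -lerBlDl.
  pose n := Num.bound e^-1.
  have nA : fine (P (F n)) <= fine (P A).
    rewrite -lee_fin !PfE//; apply: le_measure; rewrite ?inE; [exact: mC|exact: mC|].
    exact: bigcup_sup.
  have ne : n.+1%:R^-1 <= e.
    rewrite invf_ple ?posrE//.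
    have /archi_boundP/ltW/le_trans -> // : 0 <= e^-1 by rewrite invr_ge0 ltW.
    by rewrite ler_nat.
  apply: le_trans (le_trans (ltW (HF n).2) nA).
  by rewrite lerD2l lerN2.
exists A; split=> // B CB.
have CAB : C (A `|` B).
  (* The padding of [bigcup2] by [set0], which may lie outside [C], is replaced by repetitions of
     [B]. *)
  rewrite -bigcup2E (_ : bigcup2 A B = fun n => if n == 0%N then A else
    if n == 1%N then B else set0); last by apply/funext => -[|[]].
  have -> : \bigcup_n (if n == 0%N then A else if n == 1%N then B else set0) =
      \bigcup_n (if n == 0%N then A else B).
    apply/seteqP; split => w [[|[|n]] _ //= Hw]; [by exists 0%N|by exists 1%N|
      by exists 0%N|by exists 1%N|by exists 1%N].
  by apply: CU => -[|n].
have mBA : measurable (B `\` A) by apply: measurableD; exact: mC.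
have : (P (A `|` B) <= P A)%E.
  rewrite -(PfE _ CAB) -(PfE _ CA) lee_fin; apply: le_trans supA.
  by apply: ub_le_sup; [case: supS|exists (A `|` B)].
have -> : A `|` B = A `|` (B `\` A).
  apply/seteqP; split => w [Aw|]; [by left| |by left|by move=> []; right].
  by have [Aw|nAw] := pselect (A w); [left|right].
rewrite measureU//; [|exact: mC|by rewrite setDE setICA setICr setI0].
rewrite -[leRHS]adde0 leeD2lE ?fin_num_measure//; last exact: mC.
by move=> h; apply/eqP; rewrite eq_le h measure_ge0.
Qed.

Section StrictlyPositive.
Context {d : measure_display} {T : measurableType d} {R : realType}.
Variables (P : probability T R) (X : set (T -> R)) (N : (T -> R) -> R).
Hypothesis HXN : banach_function_space P X N.
Hypothesis Xconst : forall c : R, X (fun _ => c).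
Variables (M : set (T -> R)) (pi : (T -> R) -> R).
Hypotheses (MC : forall c : R, M (fun _ => c))
  (ML : forall (a : R) x y, M x -> M y -> M (fun w => a * x w + y w))
  (lpi : linear_on P M pi) (ppi : positive_on P M pi)
  (nfl : no_free_lunch P X M pi).

Let HX : is_ideal P X. Proof. by case: HXN. Qed.
Let X0 : X (fun _ => 0) := Xconst 0.
Let Xind (A : set T) : measurable A -> X \1_A := @ideal_indic _ _ _ P X HX Xconst A.

Let indic_ge0 (A : set T) : aele P (fun _ => 0) (\1_A : T -> R).
Proof. by apply: aeW => w; rewrite indicE ler0n. Qed.

Lemma positive_null_sub phi (A B : set T) : linear_on P X phi ->
  positive_on P X phi -> measurable A -> measurable B -> A `<=` B ->
  phi \1_B = 0 -> phi \1_A = 0.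
Proof.
move=> lphi pphi mA mB AB phiB; apply/eqP; rewrite eq_le.
rewrite -{1}phiB (positive_on_le HX lphi pphi) ?pphi//; try exact: Xind.
by apply: aeW => w; exact: indic_le.
Qed.

Lemma positive_null_setU phi (A B : set T) : linear_on P X phi ->
  positive_on P X phi -> measurable A -> measurable B ->
  phi \1_A = 0 -> phi \1_B = 0 -> phi \1_(A `|` B) = 0.
Proof.
move=> lphi pphi mA mB phiA phiB.
have mAB := measurableU _ _ mA mB.
have [_ _ XD _ _] := HX; have [XA XB] := (Xind mA, Xind mB).
apply/eqP; rewrite eq_le pphi ?andbT//; last exact: Xind.
rewrite -[leRHS]addr0 -{1}phiA -phiB -(linear_onD lphi)//.
apply: (positive_on_le HX lphi pphi); [exact: Xind|exact: XD|].
apply: aeW => w /=; have [[Aw|Bw]|nAB] := pselect ((A `|` B) w).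
- by rewrite (indic_in (or_introl Aw : (A `|` B) w)) (indic_in Aw) lerDl indicE.
- by rewrite (indic_in (or_intror Bw : (A `|` B) w)) (indic_in Bw) lerDr indicE.
- by rewrite (indic_notin nAB) addr_ge0// indicE.
Qed.

Lemma positive_null_bigcup phi (F : nat -> set T) : order_continuous P X phi ->
  positive_on P X phi -> (forall n, measurable (F n)) ->
  (forall n, phi \1_(F n) = 0) -> phi \1_(\bigcup_n F n) = 0.
Proof.
move=> ophi pphi mF phiF; rewrite -bigcup_bigsetU_bigcup.
have mG n : measurable (\big[setU/set0]_(i < n) F i) by exact: bigsetU_measurable.
apply: (order_continuous_bigcup HX Xconst ophi) => // n.
  by rewrite [X in _ `<=` X]big_ord_recr/=; exact: subsetUl.
elim: n.+1 => {n} [|n IH].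
  by rewrite big_ord0 indic0; exact: (linear_on0 X0 ophi.1).
by rewrite big_ord_recr/=; exact: (positive_null_setU ophi.1 pphi (mG n) (mF n) IH).
Qed.

(** This is the class to be exhausted: [pricing_equivalent] shows that its essentially largest
    member has full measure. *)
Let covered : set (set T) := [set A | measurable A /\
  exists psi, pricing P X M pi psi /\ forall B, measurable B -> B `<=` A ->
    psi \1_B = 0 -> P B = 0%E].

Lemma pricing_indic_gt0 (A : set T) : measurable A -> P A != 0%E ->
  exists phi, pricing P X M pi phi /\ 0 < phi \1_A.
Proof.
move=> mA PA0.
apply: (no_free_lunch_pricing HXN MC ML lpi nfl) => //; first exact: Xind.
move=> [N0 [mN0 PN0 subN0]]; move: PA0; rewrite -measure_le0.
rewrite -PN0 le_measure ?inE//; apply: subset_trans subN0 => w Aw /=.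
by rewrite indic_in// => /eqP; rewrite oner_eq0.
Qed.

(** A set that is null for the weighted sum of the functionals is null for each of them, so its part
    in each [F n] is [P]-null. *)
Lemma covered_bigcup (F : nat -> set T) : (forall n, covered (F n)) ->
  covered (\bigcup_n F n).
Proof.
move=> cF; have mF n : measurable (F n) by case: (cF n).
split; first exact: bigcup_measurable.
have [phis Hphis] := choice (fun n => (cF n).2).
have pphis n : pricing P X M pi (phis n) by case: (Hphis n).
have [psi [ppsi psi0]] := pricing_countable_sum HXN pphis.
exists psi; split=> // B mB BF psiB.
have [[opsi _] posi _] := ppsi.
rewrite -(setIidl BF) setI_bigcupr.
apply/eqP; rewrite -measure_le0.
apply: (le_trans (measure_sigma_subadditive _ _ _ (fun _ => id))).
- by move=> n; exact: measurableI.
- by apply: bigcup_measurable => n _; exact: measurableI.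
rewrite eseries0// => n _ _; have mBF := measurableI _ _ mB (mF n).
have [_] := Hphis n; apply=> //; apply: psi0 => //; first exact: Xind.
exact: (positive_null_sub opsi posi mBF mB).
Qed.

Lemma pricing_equivalent : exists psi, pricing P X M pi psi /\
  forall B, measurable B -> psi \1_B = 0 -> P B = 0%E.
Proof.
(* Even the empty set needs some pricing functional as a witness; one charging the whole space is
   taken. *)
have c0 : covered set0.
  split=> //; have PT : P setT != 0%E by rewrite probability_setT onee_neq0.
  have [phi [pphi _]] := pricing_indic_gt0 measurableT PT.
  by exists phi; split=> // B _; rewrite subset0 => -> _; rewrite measure0.
have [A [[mA [psi [ppsi psiA]]] Amax]] : exists A, covered A /\
    forall B, covered B -> P (B `\` A) = 0%E.
  apply: essential_bigcup => [B []//||]; first by exists set0.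
  exact: covered_bigcup.
have mAC := measurableC mA.
have PAC : P (~` A) = 0%E.
  apply/eqP/negPn/negP => PAC.
  have [phi [pphi phiAC]] := pricing_indic_gt0 mAC PAC.
  have [ophi posphi _] := pphi.
  (* A second exhaustion, now over the null sets of [phi]. *)
  have [Z [[mZ phiZ] Zmax]] : exists Z, (measurable Z /\ phi \1_Z = 0) /\
      forall B, measurable B /\ phi \1_B = 0 -> P (B `\` Z) = 0%E.
    apply: (@essential_bigcup _ _ _ P [set Z | measurable Z /\ phi \1_Z = 0]).
    - by move=> B [].
    - by exists set0; split=> //; rewrite indic0; exact: (linear_on0 X0 ophi.1).
    - move=> F HF; split; first by apply: bigcup_measurable => n _; case: (HF n).
      by apply: positive_null_bigcup => // n; case: (HF n).
  have cZ : covered (~` Z).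
    split; first exact: measurableC.
    exists phi; split=> // B mB BZ phiB.
    by rewrite -(Zmax B (conj mB phiB)) setDE setIidl.
  have mZA : measurable (~` Z `\` A) by apply: measurableD => //; exact: measurableC.
  have phi0 : phi \1_(~` Z `\` A) = 0.
    rewrite -(linear_on0 X0 ophi.1); apply: ophi.1.2 => //; first exact: Xind.
    by apply: aeeq_indic0 => //; exact: Amax.
  move: phiAC; rewrite (@positive_null_sub phi _ (Z `|` (~` Z `\` A)) ophi.1)//.
  - by rewrite ltxx.
  - exact: measurableU.
  - by move=> w Aw; have [Zw|nZw] := pselect (Z w); [left|right].
  - exact: (positive_null_setU ophi.1).
exists psi; split=> // B mB psiB; have [opsi posi _] := ppsi.
have mBA := measurableI _ _ mB mA.
have PBA : P (B `&` A) = 0%E.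
  by apply: psiA => //; exact: (positive_null_sub opsi.1 posi mBA mB).
rewrite -(setUIDK B A); apply/eqP; rewrite -measure_le0.
have mBD := measurableD mB mA.
apply: (le_trans (measureU2 _ mBA mBD)); rewrite [X in (X + _)%E]PBA add0e -PAC.
by apply: le_measure; rewrite ?inE// => w [].
Qed.

(** A nonzero [x >= 0] is at least [1 / (n + 1)] on a non-null set for some [n], so it dominates a
    multiple of an indicator that [psi] charges. *)
Lemma pricing_strictly_positive : exists psi, pricing P X M pi psi /\
  strictly_positive P X psi.
Proof.
have [psi [ppsi psiB]] := pricing_equivalent; exists psi; split=> //.
have [opsi posi _] := ppsi; move=> x Xx x0 nx0.
have mx : measurable_fun setT x by have [+ _ _ _ _] := HX; exact.
pose A n := x @^-1` `[n.+1%:R^-1, +oo[.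
have mA n : measurable (A n).
  by rewrite -[X in measurable X]setTI; exact: mx.
have [n PAn] : exists n, P (A n) != 0%E.
  apply: contrapT => nA; apply: nx0.
  have : {ae P, forall w, forall n, ~ A n w}.
    apply/ae_foralln => n; exists (A n); split=> //.
      by apply/eqP/negPn/negP => PA; apply: nA; exists n.
    by move=> w /= /contrapT.
  move/filterS2: x0; apply => w xw0 nAw.
  apply/eqP; rewrite eq_le xw0 andbT leNgt; apply/negP => xw.
  apply: (nAw (Num.bound (x w)^-1)); rewrite /A /= in_itv/= andbT.
  rewrite invf_ple ?posrE//.
  have /archi_boundP/ltW/le_trans -> // : 0 <= (x w)^-1 by rewrite invr_ge0 ltW.
  by rewrite ler_nat.
have psiA : 0 < psi \1_(A n).
  rewrite lt_def posi ?andbT//; last exact: Xind.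
  by apply/negP => /eqP /(psiB _ (mA n)) PA0; rewrite PA0 eqxx in PAn.
have c0 : (0 : R) < n.+1%:R^-1 by rewrite invr_gt0.
have [_ _ _ XZ _] := HX.
apply: (lt_le_trans (mulr_gt0 c0 psiA)).
rewrite -(linear_onZ _ X0 opsi.1); last exact: Xind.
apply: (positive_on_le HX opsi.1 posi) => //; first by apply: XZ; exact: Xind.
apply: filterS x0 => w xw0; have [Aw|nAw] := pselect (A n w).
  by rewrite indic_in// mulr1; move: Aw; rewrite /A /= in_itv/= andbT.
by rewrite indic_notin// mulr0.
Qed.

(* Elements of [M] are only a.e. equal to measurable functions, hence possibly
   outside [X]; order continuity leaves the values there free. *)
Lemma kreps_yan : exists xs, [/\ order_continuous P X xs,
  strictly_positive P X xs & forall m, M m -> xs m = pi m].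
Proof.
have [psi [[opsi posi psi0] spsi]] := pricing_strictly_positive.
have n1 : ~ aeeq P (fun _ => 1 : R) (fun _ => 0).
  move=> [Z [mZ PZ subZ]].
  have : (P setT <= P Z)%E.
    apply: le_measure; rewrite ?inE//; apply: subset_trans subZ => w _ /=.
    by move=> /eqP; rewrite oner_eq0.
  by rewrite PZ probability_setT leNgt lte01.
have pos1 : aele P (fun _ => 0) (fun _ => 1 : R) by apply: aeW.
have psi1 : 0 < psi (fun _ => 1) by exact: spsi.
have pi1 : 0 < pi (fun _ => 1).
  (* If [pi 1 = 0], the constant 1 itself lies in [M_0 - X_+] and is a free lunch. *)
  rewrite lt_def ppi ?andbT//; apply/eqP => pi1.
  apply: n1; apply: nfl => //; split=> // n phis _ e e0.
  exists (fun _ => 1); split; last by move=> i; rewrite subrr normr0.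
  exists (fun _ => 1), (fun _ => 0); split; first exact: MC.
  split=> //; split=> //; split; first exact: aeW.
  by apply/funext => w /=; rewrite subr0.
set r := pi (fun _ => 1) / psi (fun _ => 1).
have r0 : 0 < r by rewrite divr_gt0.
pose xs x := if `[< X x >] then r * psi x else pi x.
have xsX x : X x -> xs x = r * psi x by move=> Xx; rewrite /xs asboolT.
exists xs; split.
- apply: dominated_order_continuous.
    split=> [a x y Xx Xy|x y Xx Xy xy].
      rewrite !xsX//; first by rewrite opsi.1.1//; ring.
      exact: (idealZD _ HX).
    by rewrite !xsX// (opsi.1.2 _ _ Xx Xy xy).
  move=> z e Xz e0; exists 1%N, (fun _ => psi), r; split=> // [|x Xx _].
    exact: ltW.
  by rewrite big_ord1 xsX// normrM gtr0_norm// lerDl ltW.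
- by move=> x Xx x0 nx0; rewrite xsX// mulr_gt0//; exact: spsi.
- move=> m Mm; rewrite /xs; case: asboolP => // Xm.
  (* The claim [m - t 1] has price 0, so [psi] vanishes on it and [psi m = t psi 1]; the factor [r]
     turns this into [pi m]. *)
  pose t := pi m / pi (fun _ => 1).
  have Mt : M (fun w => - t * 1 + m w) by apply: ML.
  have Xt : X (fun w => - t * 1 + m w) by apply: (idealZD _ HX).
  have := psi0 _ Mt Xt; rewrite lpi.1// opsi.1.1//.
  have -> : - t * pi (fun _ => 1) + pi m = 0.
    by rewrite /t mulNr divfK ?gt_eqF// addNr.
  move=> /(_ erefl) psim; have -> : psi m = t * psi (fun _ => 1) by lra.
  have [pi1_neq0 psi1_neq0] := (lt0r_neq0 pi1, lt0r_neq0 psi1).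
  by rewrite /r /t; field; rewrite pi1_neq0 psi1_neq0.
Qed.

End StrictlyPositive.

(** * Prices determined by the span of the calls *)

Lemma O_span_linear {d : measure_display} {T : measurableType d} {R : realType}
    (P : probability T R) (f : T -> R) (a : R) x y :
  O_span P f x -> O_span P f y -> O_span P f (fun w => a * x w + y w).
Proof.
move=> [n [c [b [k xE]]]] [n' [c' [b' [k' yE]]]].
exists (n + n')%N, (a * c + c'),
  (fun i => match fintype.split i with inl j => a * b j | inr j => b' j end),
  (fun i => match fintype.split i with inl j => k j | inr j => k' j end).
apply: filterS2 xE yE => w -> ->.
rewrite big_split_ord/= mulrDr addrACA; congr (_ + (_ + _)).
  rewrite mulr_sumr; apply: eq_bigr => i _.
  by rewrite (unsplitK (inl i)) mulrA.
by apply: eq_bigr => i _; rewrite (unsplitK (inr i)).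
Qed.

Theorem theorem3p4 (d : measure_display) (T : measurableType d) (R : realType)
  (P : probability T R) (X : set (T -> R)) (N : (T -> R) -> R)
  (HX : banach_function_space P X N)
  (Hconst : forall c : R, X (fun _ => c))
  (f : T -> R) (Hf : X f) (Hf0 : aele P (fun _ => 0) f)
  (pi : (T -> R) -> R)
  (Hpi_lin : linear_on P (O_span P f) pi)
  (Hpi_pos : positive_on P (O_span P f) pi)
  (HNFL : no_free_lunch P X (O_span P f) pi) :
  forall g : T -> R, L0_sigma_f P f g -> X g ->
    price_determined P X (O_span P f) pi g.
Proof.
move=> g gf Xg; have [HXi _] := HX.
have [xs [oxs sxs xspi]] := kreps_yan HX Hconst (O_span_const P f)
  (@O_span_linear _ _ _ P f) Hpi_lin Hpi_pos HNFL.
have cp : consistent_price P X (O_span P f) pi g (xs g) by exists xs.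
exists (xs g); split=> // q cq.
exact: (consistent_price_unique HXi Hconst Hf Xg gf cp cq).
Qed.
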